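(* Let $d=1$. If $u:[0,T]\times\Omega\to\mathbb{R}$ is a viscosity supersolution of the terminal value problem $$\partial_tu+\inf_{a\in A}\Big[b(t,\mathbf{x},a)\,\partial_{\mathbf{x}}u+\tfrac12\sigma^2(t,\mathbf{x},a)\,\partial^2_{\mathbf{x}\mathbf{x}}u\Big]=0\ \text{ on }[0,T)\times\Omega,\qquad u(T,\mathbf{x})=h(\mathbf{x})\ \text{ on }\Omega,$$ then $u$ is a quasi-contingent supersolution of this terminal value problem.
   Context: Setting ($d=1$). Fix $T\in(0,\infty)$. $\Omega=C(\mathbb{R}_+,\mathbb{R})$, $\mathbb{P}$ is Wiener measure on $\mathcal{B}(\Omega)$ with expectation $\mathbb{E}$, $W_t(\omega)=\omega(t)$ is the canonical process, $\mathbb{F}=(\mathcal{F}_t)_{t\ge0}$, $\mathcal{F}_t=\sigma(W_s:0\le s\le t)$. For $t\ge 0$, $\mathbb{F}^t=(\mathcal{F}^t_s)_s$ with $\mathcal{F}^t_s=\sigma(W_r-W_t:t\le r\le s)$ for $s\ge t$ and $\mathcal{F}^t_s=\{\emptyset,\Omega\}$ for $s<t$. $\mathbb{L}^0(\mathbb{F}^t,\mathbb{R})$ is the set of real $\mathbb{F}^t$-progressive processes on $\mathbb{R}_+\times\Omega$; $\mathbb{L}^2(\mathbb{F}^t,\mathbb{P},\mathbb{R})$ is the set of $X\in\mathbb{L}^0(\mathbb{F}^t,\mathbb{R})$ with $\|X\|^2_{\mathbb{L}^2(\mathbb{F}^t,\mathbb{P},\mathbb{R})}:=\mathbb{E}[\int_t^\infty|X_s|^2ds]<\infty$.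 $\llbracket\tau_1,\tau_2\rrbracket=\{(s,\omega):\tau_1(\omega)\le s\le\tau_2(\omega)\}$. Subsets of $\mathbb{R}_+\times\Omega$ carry the pseudo-metric $|t-t'|+\|\mathbf{x}_{\cdot\wedge t}-\mathbf{x}'_{\cdot\wedge t'}\|_\infty$; (semi)continuity is with respect to it (so semicontinuous functions are non-anticipating). Data and standing assumptions. $A$ is a Borel subset of $[0,1]$; $(a^\circ,p^\circ,q^\circ)\in A\times\mathbb{R}\times\mathbb{R}$ is fixed. $b,\sigma:\mathbb{R}_+\times\Omega\times A\to\mathbb{R}$, $h:\Omega\to\mathbb{R}$ satisfy: (A1) $h$ is $\mathcal{F}_T$-measurable, $b,\sigma$ are Borel measurable, $(b,\sigma)(t,\mathbf{x},a)=\mathbf{1}_{[0,T]}(t)\,(b,\sigma)(t,\mathbf{x}_{\cdot\wedge t},a)$, $h(\mathbf{x})=h(\mathbf{x}_{\cdot\wedge T})$; (A2) there is $L_b\ge1$ with $|b(t,\mathbf{x},a)-b(t,\tilde{\mathbf{x}},a)|+|\sigma(t,\mathbf{x},a)-\sigma(t,\tilde{\mathbf{x}},a)|\le L_b\|\mathbf{x}_{\cdot\wedge t}-\tilde{\mathbf{x}}_{\cdot\wedge t}\|_\infty$ and $|b(t,\mathbf{x},a)|+|\sigma(t,\mathbf{x},a)|+|h(\mathbf{x})|\le L_b$ for all arguments. Controls. $\mathcal{A}$ is the set of $\mathbb{F}$-predictable $a:\mathbb{R}_+\times\Omega\to A$; $\mathcal{A}^t$ is the set of $a\in\mathcal{A}$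 that are $\mathbb{F}^t$-predictable with $a|_{\llbracket0,t\rrbracket}=a^\circ$. By convention, every pair in $\mathbb{L}^2(\mathbb{F}^t,\mathbb{P},\mathbb{R})^2$ equals $(p^\circ,q^\circ)$ on $\llbracket0,t\rrbracket$ (values before $t$ play no role). Processes. $X=X^{t,\mathbf{x};\beta,\varsigma;p,q}$ is given by $X_s=\mathbf{x}_s$ on $[0,t]$ and $X_s=\mathbf{x}_t+\int_t^s[\beta_r+p_r]dr+\int_t^s[\varsigma_r+q_r]dW_r$ for $s>t$ (up to time $t+\delta$ when only needed there), $\mathbb{P}$-a.s.; $X^{t,\mathbf{x};\beta,\varsigma}:=X^{t,\mathbf{x};\beta,\varsigma;0,0}$. $\mathbf{O}^t_{\varepsilon,\delta}$ is the set of $(p,q)\in\mathbb{L}^0(\mathbb{F}^t,\mathbb{R})^2$ with $\|\mathbf{1}_{\llbracket t,t+\delta\rrbracket}p\|^2_{\mathbb{L}^2(\mathbb{F}^t,\mathbb{P},\mathbb{R})}+\|\mathbf{1}_{\llbracket t,t+\delta\rrbracket}q\|^2_{\mathbb{L}^2(\mathbb{F}^t,\mathbb{P},\mathbb{R})}\le\varepsilon\delta$. Path derivatives. For $t\in[0,T)$, $C^{1,2}_b([t,T]\times\Omega)$ is the set of bounded continuous $\varphi:[t,T]\times\Omega\to\mathbb{R}$ for which there are bounded continuous $\partial_t\varphi,\partial_{\mathbf{x}}\varphi,\partial^2_{\mathbf{x}\mathbf{x}}\varphi:[t,T]\times\Omega\to\mathbb{R}$ such that for all $\mathbf{x}\in\Omega$,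 $(\beta,\varsigma)\in\mathbb{L}^2(\mathbb{F}^t,\mathbb{P},\mathbb{R})^2$ and $t\le t_1<t_2\le T$, with $X=X^{t,\mathbf{x};\beta,\varsigma}$, $\mathbb{P}$-a.s., $\varphi(t_2,X)-\varphi(t_1,X)=\int_{t_1}^{t_2}[\partial_t\varphi(s,X)+\beta_s\partial_{\mathbf{x}}\varphi(s,X)+\frac12\varsigma_s^2\partial^2_{\mathbf{x}\mathbf{x}}\varphi(s,X)]ds+\int_{t_1}^{t_2}\varsigma_s\partial_{\mathbf{x}}\varphi(s,X)dW_s$; these derivatives are uniquely determined. For $a\in A$ and $\varphi\in C^{1,2}_b([t,T]\times\Omega)$, $\mathcal{L}^a\varphi(t,\mathbf{x}):=\partial_t\varphi(t,\mathbf{x})+b(t,\mathbf{x},a)\partial_{\mathbf{x}}\varphi(t,\mathbf{x})+\frac12\sigma^2(t,\mathbf{x},a)\partial^2_{\mathbf{x}\mathbf{x}}\varphi(t,\mathbf{x})$. $\mathcal{E}_+(t,\mathbf{x})$ is the set of $(\beta,\varsigma)\in\mathbb{L}^2(\mathbb{F}^t,\mathbb{P},\mathbb{R})^2$ for which there is $a\in\mathcal{A}^t$ with $(\beta,\varsigma)(s,\omega)=(b,\sigma)(s,\mathbf{x}_{\cdot\wedge t},a(s,\omega))$ for $ds\times d\mathbb{P}$-a.e. $(s,\omega)\in[t,T]\times\Omega$. Viscosity supersolution. For $(t,\mathbf{x})\in[0,T)\times\Omega$ and $\mathcal{E}\subset\mathbb{L}^2(\mathbb{F}^t,\mathbb{P},\mathbb{R})^2$,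 $\overline\Phi^{\mathcal{E}}u(t,\mathbf{x})$ is the set of $\varphi\in C^{1,2}_b([t,T]\times\Omega)$ for which there is $\varepsilon>0$ such that for all $\delta\in(0,\varepsilon]$ (with $t+\delta\le T$), $(\beta,\varsigma)\in\mathcal{E}$, $(p,q)\in\mathbf{O}^t_{\varepsilon,\delta}$: $0=(\varphi-u)(t,\mathbf{x})\ge\mathbb{E}[(\varphi-u)(t+\delta,X^{t,\mathbf{x};\beta,\varsigma;p,q})]$. $u$ is a viscosity supersolution if $u$ is l.s.c. and bounded from below, $u(T,\cdot)\ge h$, and $\inf_{a\in A}\mathcal{L}^a\varphi(t,\mathbf{x})\le0$ for all $(t,\mathbf{x})\in[0,T)\times\Omega$ and $\varphi\in\overline\Phi^{\mathcal{E}_+(t,\mathbf{x})}u(t,\mathbf{x})$. Quasi-contingent supersolution. For $u$ bounded from below, $D^{1,2}_\uparrow u(t,\mathbf{x})(\mathcal{E}):=\sup_{\varepsilon>0}\inf\{\mathbb{E}[\delta^{-1}(u(t+\delta,X^{t,\mathbf{x};\beta,\varsigma;p,q})-u(t,\mathbf{x}))]:(\beta,\varsigma)\in\mathcal{E},\delta\in(0,\varepsilon\wedge(T-t)],(p,q)\in\mathbf{O}^t_{\varepsilon,\delta}\}$. $u$ is a quasi-contingent supersolution if $u$ is l.s.c. and bounded from below, $u(T,\cdot)\ge h$, and $D^{1,2}_\uparrow u(t,\mathbf{x})(\mathcal{E}_+(t,\mathbf{x}))\le0$ for all $(t,\mathbf{x})\in[0,T)\times\Omega$. *)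

(* Defs.v *)
From HB Require Import structures.
From mathcomp Require Import all_boot all_order all_algebra.
From mathcomp Require Import all_classical all_reals all_analysis.

Set Implicit Arguments.
Unset Strict Implicit.
Unset Printing Implicit Defensive.

Import Order.TTheory GRing.Theory Num.Theory.
Import numFieldNormedType.Exports.

Local Open Scope classical_set_scope.
Local Open Scope ring_scope.

(* C(R_+, R), encoded as the continuous functions on R that are constant on
   the negative half-line, hence determined by their restriction to R_+.
   Likewise a process on R_+ x Omega is a function on R x Omega whose values
   at negative times are never used. *)
Record cpath (R : realType) := CPath {
  path_fun :> R -> R ;
  path_continuous : continuous path_fun ;
  path_neg : forall s, s <= 0 -> path_fun s = path_fun 0 }.

Section path_space.
Context {R : realType}.
Implicit Types x y : cpath R.

HB.instance Definition _ := gen_eqMixin (cpath R).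
HB.instance Definition _ := gen_choiceMixin (cpath R).

Definition path0 : cpath R :=
  @CPath R (fun=> 0) (fun=> cvg_cst _) (fun _ _ => erefl).

HB.instance Definition _ := isPointed.Build (cpath R) path0.

Lemma stop_continuous t x : continuous (fun r => x (Num.min r t)).
Proof.
move=> r; apply: (@continuous_comp _ _ _ (fun r => Num.min r t) x).
  by apply: continuous_min; [exact: cvg_id|exact: cvg_cst].
exact: path_continuous.
Qed.

Lemma stop_neg t x s : s <= 0 -> x (Num.min s t) = x (Num.min 0 t).
Proof.
move=> s0; rewrite path_neg ?ge_min ?s0//.
by rewrite [RHS]path_neg ?ge_min ?lexx.
Qed.

Definition stop t x : cpath R :=
  CPath (@stop_continuous t x) (@stop_neg t x).

(* sup-distance on R_+; only meaningful for bounded x - y, and therefore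
   only applied to stopped paths *)
Definition supdist x y : R := sup [set `|x r - y r| | r in `[0, +oo[].

(* locally uniform convergence on R_+; generates the Borel sets of Omega *)
Definition path_open : set (set (cpath R)) :=
  [set U | forall x, U x -> exists N e, [/\ 0 <= N, 0 < e &
     forall y, supdist (stop N x) (stop N y) < e -> U y]].

Definition pdist (z z' : R * cpath R) : R :=
  `|z.1 - z'.1| + supdist (stop z.1 z.2) (stop z'.1 z'.2).

Definition pcontinuous (D : set (R * cpath R)) (f : R -> cpath R -> R) :=
  forall z, D z -> forall e, 0 < e -> exists2 d, 0 < d &
    forall z', D z' -> pdist z z' < d -> `|f z'.1 z'.2 - f z.1 z.2| < e.

Definition plsc (D : set (R * cpath R)) (f : R -> cpath R -> R) :=
  forall z, D z -> forall e, 0 < e -> exists2 d, 0 < d &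
    forall z', D z' -> pdist z z' < d -> f z.1 z.2 - e < f z'.1 z'.2.

Definition pbounded (D : set (R * cpath R)) (f : R -> cpath R -> R) :=
  exists M, forall z, D z -> `|f z.1 z.2| <= M.

Definition pbounded_below (D : set (R * cpath R)) (f : R -> cpath R -> R) :=
  exists M, forall z, D z -> M <= f z.1 z.2.

End path_space.

Notation Omega R := (g_sigma_algebraType (@path_open R)).

Section filtrations.
Context {R : realType}.
Implicit Types F : R -> set (set (cpath R)).

Definition filtW (t : R) : set (set (cpath R)) :=
  <<s [set S | exists s (B : set R), [/\ 0 <= s <= t, measurable B &
         S = (fun w : cpath R => w s) @^-1` B]] >>.

(* trivial if s < t since there are no generators *)
Definition filtIncr (t s : R) : set (set (cpath R)) :=
  <<s [set S | exists r (B : set R), [/\ t <= r <= s, measurable B &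
         S = (fun w : cpath R => w r - w t) @^-1` B]] >>.

Definition measurable_wrt (G : set (set (cpath R))) (f : cpath R -> R) :=
  measurable_fun setT (f : g_sigma_algebraType G -> R).

Definition progressive F (X : R -> cpath R -> R) :=
  forall s : R, 0 <= s ->
    measurable_fun [set z : R * g_sigma_algebraType (F s) | 0 <= z.1 <= s]
    (fun z : R * g_sigma_algebraType (F s) => X z.1 z.2).

Definition predictable_rect F : set (set (R * cpath R)) :=
  [set Z | exists2 E, F 0 E & Z = [set 0] `*` E] `|`
  [set Z | exists s r E, [/\ 0 <= s < r, F s E & Z = `]s, r] `*` E]].

Definition predictable F (X : R -> cpath R -> R) :=
  measurable_fun [set z : g_sigma_algebraType (predictable_rect F) | 0 <= z.1]
    (fun z : g_sigma_algebraType (predictable_rect F) => X z.1 z.2).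

End filtrations.

Section wiener.
Context {R : realType}.
Implicit Types P : probability (Omega R) R.

(* P is the law under which the canonical process is a standard Brownian
   motion started at 0 *)
Definition wiener_measure P :=
  P [set w : cpath R | w 0 = 0] = 1%E /\
  forall s t (E : set (cpath R)) (B : set R), 0 <= s -> s < t ->
    filtW s E -> measurable B ->
    P (E `&` [set w : cpath R | B (w t - w s)]) =
      (P E * normal_prob 0 (Num.sqrt (t - s)) B)%E.

(* sum_(i < m) c_i 1_{]s_i, s_{i+1}]} *)
Record simple_process := SimpleProcess {
  sp_size : nat ;
  sp_time : nat -> R ;
  sp_coef : nat -> cpath R -> R }.

Definition simple_adapted (t : R) (S : simple_process) :=
  [/\ t <= sp_time S 0,
      forall i, sp_time S i <= sp_time S i.+1,
      forall i, measurable_wrt (filtW (sp_time S i)) (sp_coef S i) &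
      exists M, forall i w, `|sp_coef S i w| <= M].

Definition simple_value (S : simple_process) (r : R) (w : cpath R) : R :=
  \sum_(i < sp_size S) sp_coef S i w * \1_(`]sp_time S i, sp_time S i.+1]) r.

Definition simple_integral (S : simple_process) (r : R) (w : cpath R) : R :=
  \sum_(i < sp_size S) sp_coef S i w *
    (w (Num.min (sp_time S i.+1) r) - w (Num.min (sp_time S i) r)).

(* (I_s)_{t <= s <= t1} is a continuous version of the Ito integral
   int_t^s xi_r dW_r: the L^2-limit of the integrals of simple processes
   that approximate xi in L^2 *)
Definition ito_integral P (t t1 : R) (xi I : R -> cpath R -> R) :=
  [/\ forall s, t <= s <= t1 -> measurable_fun setT (I s : Omega R -> R),
      {ae P, forall w : Omega R, {within `[t, t1], continuous (I ^~ w)}} &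
      exists S : nat -> simple_process,
        [/\ forall n, simple_adapted t (S n),
            (fun n => \int[P]_w \int[lebesgue_measure]_(r in `[t, t1])
                ((xi r w - simple_value (S n) r w) ^+ 2)%:E)%E
              @ \oo --> 0%E &
            forall s, t <= s <= t1 ->
              (fun n => \int[P]_w
                ((I s w - simple_integral (S n) s w) ^+ 2)%:E)%E
              @ \oo --> 0%E]].

(* X is a version of X^{t,x;beta,vsig;p,q}, the equation being required up to
   time t1 only *)
Definition is_process P (t t1 : R) (x : cpath R)
    (beta vsig p q : R -> cpath R -> R) (X : Omega R -> Omega R) :=
  measurable_fun setT X /\
  exists2 I, ito_integral P t t1 (fun r w => vsig r w + q r w) I &
    {ae P, forall w : Omega R,
      (forall s, 0 <= s <= t -> (X w : cpath R) s = x s) /\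
      (forall s, t < s <= t1 -> (X w : cpath R) s =
        x t + \int[lebesgue_measure]_(r in `[t, s]) (beta r w + p r w)
            + I s w)}.

Definition sqnorm P (t : R) (X : R -> cpath R -> R) : \bar R :=
  (\int[P]_w \int[lebesgue_measure]_(s in `[t, +oo[) ((X s w) ^+ 2)%:E)%E.

Definition L0 (t : R) : set (R -> cpath R -> R) :=
  [set X | progressive (filtIncr t) X].

(* pairs in L^2(F^t, P, R)^2, normalized to (p0, q0) on [[0, t]] *)
Definition L2pair P (p0 q0 t : R) :
    set ((R -> cpath R -> R) * (R -> cpath R -> R)) :=
  [set c | [/\ L0 t c.1, L0 t c.2,
      (sqnorm P t c.1 < +oo)%E, (sqnorm P t c.2 < +oo)%E &
      forall s w, 0 <= s <= t -> c.1 s w = p0 /\ c.2 s w = q0]].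

Definition Oset P (t eps delta : R) :
    set ((R -> cpath R -> R) * (R -> cpath R -> R)) :=
  [set c | [/\ L0 t c.1, L0 t c.2 &
      (sqnorm P t (fun s w => \1_(`[t, t + delta]%classic) s * c.1 s w)%R +
       sqnorm P t (fun s w => \1_(`[t, t + delta]%classic) s * c.2 s w)%R
         <= (eps * delta)%:E)%E]].

Definition strip (t T : R) : set (R * cpath R) := [set z | t <= z.1 <= T].

Definition zero_process (s : R) (w : cpath R) : R := 0.

(* phi(t2, X) makes sense for any version X of the process because a
   pcontinuous function only depends on the stopped path *)
Definition path_derivatives P (p0 q0 T t : R)
    (phi dt dx dxx : R -> cpath R -> R) :=
  [/\ pbounded (strip t T) dt /\ pcontinuous (strip t T) dt,
      pbounded (strip t T) dx /\ pcontinuous (strip t T) dx,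
      pbounded (strip t T) dxx /\ pcontinuous (strip t T) dxx &
      forall (x : cpath R) beta vsig t1 t2 X,
        L2pair P p0 q0 t (beta, vsig) -> t <= t1 -> t1 < t2 -> t2 <= T ->
        is_process P t T x beta vsig zero_process zero_process X ->
        exists2 J,
          ito_integral P t1 t2 (fun s w => vsig s w * dx s (X w)) J &
          {ae P, forall w : Omega R,
            phi t2 (X w) - phi t1 (X w) =
              \int[lebesgue_measure]_(s in `[t1, t2])
                (dt s (X w) + beta s w * dx s (X w)
                 + 2^-1 * (vsig s w) ^+ 2 * dxx s (X w))
              + J t2 w}].

Definition C12b P (p0 q0 T t : R) : set (R -> cpath R -> R) :=
  [set phi | [/\ pbounded (strip t T) phi, pcontinuous (strip t T) phi &
     exists dt dx dxx, path_derivatives P p0 q0 T t phi dt dx dxx]].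

End wiener.

Section control.
Context {R : realType}.
Variables (P : probability (Omega R) R) (T : R) (A : set R) (a0 p0 q0 : R).
Variables (b sigma : R -> cpath R -> R -> R) (h : cpath R -> R).

Definition assumption_A1 :=
  [/\ measurable_wrt (filtW T) h,
      measurable_fun [set z : R * Omega R * R | 0 <= z.1.1 /\ A z.2]
        (fun z => b z.1.1 z.1.2 z.2),
      measurable_fun [set z : R * Omega R * R | 0 <= z.1.1 /\ A z.2]
        (fun z => sigma z.1.1 z.1.2 z.2),
      (forall t x a, 0 <= t -> A a ->
         b t x a = \1_(`[0, T]%classic) t * b t (stop t x) a /\
         sigma t x a = \1_(`[0, T]%classic) t * sigma t (stop t x) a) &
      forall x, h x = h (stop T x)].

Definition assumption_A2 :=
  exists2 L, 1 <= L &
    (forall t x y a, 0 <= t -> A a ->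
       `|b t x a - b t y a| + `|sigma t x a - sigma t y a|
         <= L * supdist (stop t x) (stop t y)) /\
    (forall t x a, 0 <= t -> A a ->
       `|b t x a| + `|sigma t x a| + `|h x| <= L).

Definition controls : set (R -> cpath R -> R) :=
  [set a | predictable filtW a /\ forall s w, 0 <= s -> A (a s w)].

Definition controls_from (t : R) : set (R -> cpath R -> R) :=
  [set a | [/\ controls a, predictable (filtIncr t) a &
     forall s w, 0 <= s <= t -> a s w = a0]].

Definition Eplus (t : R) (x : cpath R) :
    set ((R -> cpath R -> R) * (R -> cpath R -> R)) :=
  [set c | L2pair P p0 q0 t c /\ exists2 a, controls_from t a &
     {ae (lebesgue_measure \x P)%E,
       forall z : measurableTypeR R * Omega R, t <= z.1 <= T ->
         c.1 z.1 z.2 = b z.1 (stop t x) (a z.1 z.2) /\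
         c.2 z.1 z.2 = sigma z.1 (stop t x) (a z.1 z.2)}].

Definition generator (dt dx dxx : R -> cpath R -> R) (a t : R) (x : cpath R) : R :=
  dt t x + b t x a * dx t x + 2^-1 * (sigma t x a) ^+ 2 * dxx t x.

(* test functions for supersolutions; the expectation is extended-real, as
   phi - u is only bounded from above *)
Definition Phibar (u : R -> cpath R -> R) (t : R) (x : cpath R)
    (E : set ((R -> cpath R -> R) * (R -> cpath R -> R))) :
    set (R -> cpath R -> R) :=
  [set phi | [/\ C12b P p0 q0 T t phi, phi t x - u t x = 0 &
     exists2 eps, 0 < eps &
       forall delta beta vsig p q X, 0 < delta <= eps -> t + delta <= T ->
         E (beta, vsig) -> Oset P t eps delta (p, q) ->
         is_process P t (t + delta) x beta vsig p q X ->
         ('E_P[(fun w => phi (t + delta) (X w) - u (t + delta) (X w))%R]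
            <= 0)%E]].

(* the path derivatives of phi being unique, quantifying over all triples of
   derivatives is the same as choosing one *)
Definition viscosity_supersolution (u : R -> cpath R -> R) :=
  [/\ plsc (strip 0 T) u, pbounded_below (strip 0 T) u,
      forall x, h x <= u T x &
      forall t x phi dt dx dxx, 0 <= t -> t < T ->
        Phibar u t x (Eplus t x) phi ->
        path_derivatives P p0 q0 T t phi dt dx dxx ->
        (ereal_inf [set (generator dt dx dxx a t x)%:E | a in A] <= 0)%E].

Definition Dup (u : R -> cpath R -> R) (t : R) (x : cpath R)
    (E : set ((R -> cpath R -> R) * (R -> cpath R -> R))) : \bar R :=
  ereal_sup [set ereal_inf [set v | exists delta beta vsig p q X,
      [/\ 0 < delta <= Num.min eps (T - t),
          E (beta, vsig), Oset P t eps delta (p, q),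
          is_process P t (t + delta) x beta vsig p q X &
          v = 'E_P[(fun w => delta^-1 * (u (t + delta) (X w) - u t x))%R]%E]]
    | eps in [set eps : R | 0 < eps]].

Definition quasi_contingent_supersolution (u : R -> cpath R -> R) :=
  [/\ plsc (strip 0 T) u, pbounded_below (strip 0 T) u,
      forall x, h x <= u T x &
      forall t x, 0 <= t -> t < T -> (Dup u t x (Eplus t x) <= 0)%E].

End control.

(* Main.v *)
(** If the quasi-contingent derivative of [u] at [(t, x)] were positive, it
    would dominate some [c > 0], and then the function
    [(s, y) |-> u(t, x) + c (s - t)], whose only nonzero path derivative is
    [dt = c], would be a test function in [Phibar]; its generator is the
    constant [c], so the supersolution property would give [c <= 0]. *)

Require Import Defs.
From mathcomp Require Import all_boot all_order all_algebra.
From mathcomp Require Import all_classical all_reals all_analysis measurable_realfun.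
From mathcomp Require Import ring.

Import Order.TTheory GRing.Theory Num.Theory.
Import numFieldNormedType.Exports.
Local Open Scope classical_set_scope.
Local Open Scope ring_scope.

Lemma supdist_ge0 (R : realType) (x y : cpath R) : 0 <= supdist x y.
Proof.
(* A set without a supremum has the default [sup] value [0]; otherwise the distance at time [0] is a
   lower bound. *)
have [hs|/sup_out] := pselect (has_sup [set `|x r - y r| | r in `[0, +oo[]);
  last by rewrite /supdist => ->.
apply: (@le_trans _ _ `|x 0 - y 0|) => //.
by apply: ub_le_sup; [case: hs|exists 0; rewrite //= in_itv/= lexx].
Qed.

(** The superlevel sets of [u s] are [path_open]: at equal times [pdist] reduces to [supdist] of the
    paths stopped at [s], so semicontinuity supplies the neighbourhood. *)
Lemma plsc_measurable (R : realType) (T s : R) (u : R -> cpath R -> R) :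
  0 <= s <= T -> plsc (strip 0 T) u ->
  measurable_fun setT (u s : Omega R -> R).
Proof.
move=> sT lscu mD; apply: (measurability _ (RGenOInfty.measurableE R)) => //.
move=> _ [_ [c ->] <-]; rewrite setTI; apply: sub_sigma_algebra.
move=> x; rewrite /= in_itv/= andbT => cx.
have e0 : 0 < u s x - c by rewrite subr_gt0.
have [d d0 /= lscx] := lscu (s, x) sT _ e0.
exists s, d; split=> //; first by case/andP: sT.
move=> y xy; rewrite /= in_itv/= andbT.
have := lscx (s, y) sT; rewrite /pdist/= subrr normr0 add0r opprB addrC subrK.
exact.
Qed.

(* If f is not integrable then the left-hand side is -oo, because the
   integrand is bounded from above. *)
Lemma expectation_sub_le0 d (S : measurableType d) (R : realType)
    (P : probability S R) (f : S -> R) (k m r : R) :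
  measurable_fun setT f -> (forall w, m <= f w) -> 0 < r ->
  (k%:E <= 'E_P[f])%E -> ('E_P[(fun w => r * (k - f w))%R] <= 0)%E.
Proof.
move=> mf fm r0 kf.
have [|nif] := pselect (P.-integrable setT (EFin \o f)).
  move=> intf.
  have intk : P.-integrable setT (EFin \o cst k).
    exact: finite_measure_integrable_cst.
  rewrite unlock; under eq_integral do rewrite EFinM.
  rewrite integralZl//; last by have := integrableB measurableT intk intf.
  rewrite pmule_rle0 ?lte_fin// integralB_EFin// integral_cst//=.
  by rewrite probability_setT mule1 sube_le0; move: kf; rewrite unlock.
pose W w := r * (k - f w).
have mW : measurable_fun setT W.
  by apply: measurable_funM => //; apply: measurable_funB.
have mWE : measurable_fun setT (EFin \o W) by exact/measurable_EFinP.
have Wp_fin : (\int[P]_w (EFin \o W)^\+ w < +oo)%E.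
  pose B := Num.max (r * (k - m)) 0.
  apply: (@le_lt_trans _ _ (\int[P]_w (cst B%:E) w)%E).
    apply: ge0_le_integral => //.
    - exact: measurable_funepos.
    - move=> w _; rewrite funeposE/= -EFin_max lee_fin /B.
      by rewrite ge_max !le_max lexx orbT andbT ler_pM2l// lerD2l lerN2 fm.
  by rewrite integral_cst//= probability_setT mule1 ltry.
(* Otherwise [W] would be integrable, and hence so would [f = k - r^-1 * W]. *)
have Wn_oo : (\int[P]_w (EFin \o W)^\- w = +oo)%E.
  apply/eqP; rewrite -leye_eq leNgt; apply/negP => Wn_fin; apply: nif.
  have intW : P.-integrable setT (EFin \o W).
    apply/integrableP; split => //.
    under eq_integral do rewrite -[`|_|%E]/((abse \o (EFin \o W)) _) fune_abse.
    rewrite ge0_integralD//; [exact: lte_add_pinfty|exact: measurable_funepos|].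
    exact: measurable_funeneg.
  have intk : P.-integrable setT (EFin \o cst k).
    exact: finite_measure_integrable_cst.
  have := integrableB measurableT intk (integrableZl measurableT r^-1 intW).
  apply: eq_integrable => // w _ /=; congr EFin.
  by rewrite /W mulKf ?gt_eqF// opprB addrC subrK.
rewrite unlock -[X in (X <= _)%E]/(\int[P]_w (EFin \o W) w)%E integralE Wn_oo.
by case: (\int[P]_w _)%E Wp_fin => [z| |]; rewrite ?ltxx /= ?leNye.
Qed.

(** With [dx = dxx = 0] the stochastic integral vanishes, and the Ito formula becomes
    [c * (t2 - t1)] written as the integral of [c]. *)
Lemma time_affine_path_derivatives (R : realType) (P : probability (Omega R) R)
    (p0 q0 T t c v : R) :
  path_derivatives P p0 q0 T t (fun s _ => v + c * (s - t))
    (fun _ _ => c) zero_process zero_process.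
Proof.
have cstP k : pbounded (strip t T) (fun _ _ => k) /\
    pcontinuous (strip t T) (fun _ _ => k).
  split; first by exists `|k|.
  by move=> z _ e e0; exists 1 => // z' _ _; rewrite subrr normr0.
split; [exact: cstP..|move=> x beta vsig t1 t2 X _ tt1 t12 _ _].
exists (fun _ _ => 0).
  split; first by move=> *; exact: measurable_cst.
    by apply: aeW => w; apply: continuous_subspaceT => z; exact: cvg_cst.
  (* The simple process with no summands approximates the zero integrand exactly. *)
  exists (fun=> @SimpleProcess R 0 (fun=> t1) (fun _ _ => 0)); split.
  - move=> n; split=> //=; first by move=> i; exact: measurable_cst.
    by exists 0 => i w; rewrite normr0.
  - rewrite (_ : (fun n => _) = cst 0%E); first exact: cvg_cst.
    apply/funext => n; apply: integral0_eq => w _; apply: integral0_eq => r _.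
    by rewrite /simple_value big_ord0 /zero_process mulr0 subr0 expr0n.
  - move=> s _; rewrite (_ : (fun n => _) = cst 0%E); first exact: cvg_cst.
    apply/funext => n; apply: integral0_eq => w _.
    by rewrite /simple_integral big_ord0 subr0 expr0n.
apply: aeW => w; rewrite /zero_process.
under eq_Rintegral do rewrite !mulr0 !addr0.
rewrite Rintegral_cst//= lebesgue_measure_itv/= lte_fin t12/= addr0.
ring.
Qed.

Lemma time_affine_C12b (R : realType) (P : probability (Omega R) R)
    (p0 q0 T t c v : R) :
  C12b P p0 q0 T t (fun s _ => v + c * (s - t)).
Proof.
split.
- exists (`|v| + `|c| * (T - t)) => -[s w] /= /andP[ts sT].
  rewrite (le_trans (ler_normD _ _))// lerD2l normrM ler_wpM2l//.
  by rewrite ger0_norm ?subr_ge0// lerD2r.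
(* The function is [|c|]-Lipschitz for [pdist], whose time part is at most [pdist] as [supdist] is
   nonnegative; the [+ 1] covers [c = 0]. *)
- move=> z _ e e0; exists (e / (`|c| + 1)); first by rewrite divr_gt0.
  move=> z' _; rewrite ltr_pdivlMr// /pdist => zz'.
  rewrite (_ : _ - _ = c * (z'.1 - z.1)); last by ring.
  rewrite normrM distrC (le_lt_trans _ zz')// mulrC.
  have s0 := supdist_ge0 R (stop z.1 z.2) (stop z'.1 z'.2).
  by rewrite ler_pM// ?lerDl// lerDr// ltW.
- by exists (fun _ _ => c), zero_process, zero_process;
    exact: time_affine_path_derivatives.
Qed.

Theorem theorem6p9 (R : realType) (P : probability (Omega R) R)
    (T : R) (A : set R) (a0 p0 q0 : R)
    (b sigma : R -> cpath R -> R -> R) (h : cpath R -> R)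
    (u : R -> cpath R -> R)
    (hP : wiener_measure P) (hT : 0 < T)
    (mA : measurable A) (hA : A `<=` `[0, 1]) (ha0 : A a0)
    (h1 : assumption_A1 T A b sigma h) (h2 : assumption_A2 A b sigma h)
    (hu : viscosity_supersolution P T A a0 p0 q0 b sigma h u) :
  quasi_contingent_supersolution P T A a0 p0 q0 b sigma h u.
Proof.
case: hu => lscu bndu hTu visc; split=> // t x t0 tT.
rewrite leNgt; apply/negP => /ereal_sup_gt[_ [eps eps0 <-]] Dgt0.
(* The infimum itself serves as [c] when it is finite; if it is [+oo], any positive real does. *)
have [c c0 Dc] : exists2 c : R, 0 < c & (c%:E <= ereal_inf
    [set v | exists delta beta vsig p q X,
      [/\ (0 < delta <= Num.min eps (T - t))%R,
          Eplus P T A a0 p0 q0 b sigma t x (beta, vsig),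
          Oset P t eps delta (p, q),
          is_process P t (t + delta) x beta vsig p q X &
          v = 'E_P[(fun w => delta^-1 * (u (t + delta) (X w) - u t x))%R]]])%E.
  case: (ereal_inf _) Dgt0 => [r|_|//]; first by exists r.
  by exists 1 => //; rewrite leey.
pose phi s (_ : cpath R) := u t x + c * (s - t).
have Phi : Phibar P T p0 q0 u t x (Eplus P T A a0 p0 q0 b sigma t x) phi.
  split; [exact: time_affine_C12b|by rewrite /phi subrr mulr0 addr0 subrr|].
  (* The radius of the quasi-contingent derivative is reused, so each competitor in [Phibar] also
     enters the infimum bounded below by [c]. *)
  exists eps => // delta beta vsig p q X /andP[d0 deps] tdT Ebv Opq XX.
  have td : 0 <= t + delta <= T by rewrite tdT andbT addr_ge0// ltW.
  have [m um] := bndu.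
  pose f w := delta^-1 * (u (t + delta) (X w) - u t x).
  (* With [f] the difference quotient of [u], the sign of the expectation of [phi - u] follows from
     [c] bounding that of [f] from below. *)
  rewrite (_ : (fun w => _) = (fun w => delta * (c - f w))); last first.
    apply/funext => w; rewrite /phi /f; field; exact: lt0r_neq0.
  apply: (expectation_sub_le0 _ _ _ _ _ _ (delta^-1 * (m - u t x))) => //.
  - apply: measurable_funM => //; apply: measurable_funB => //.
    apply: (measurableT_comp (plsc_measurable _ _ _ _ td lscu)).
    by case: XX.
  - move=> w; rewrite /f ler_pM2l ?invr_gt0// lerD2r.
    exact: (um (t + delta, (X w : cpath R)) td).
  - apply: (le_trans Dc); apply: ereal_inf_lbound.
    exists delta, beta, vsig, p, q, X; split=> //.
    by rewrite d0 le_min deps lerBrDl.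
have := visc _ _ _ _ _ _ t0 tT Phi (time_affine_path_derivatives _ _ _ _ _ _ _ _).
apply/negP; rewrite -ltNge (@lt_le_trans _ _ c%:E)//.
apply: le_ereal_inf_tmp => _ [a _ <-].
by rewrite /generator /zero_process !mulr0 !addr0.
Qed.
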